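(* Let $n\ge 1$ and $V=\mathbb{C}x_1\oplus\dots\oplus\mathbb{C}x_n$. There is a one-to-one correspondence between linear double Poisson brackets on the free algebra $\mathbb{C}\langle x_1,\dots,x_n\rangle$ and associative algebra structures on $V$. Explicitly, to the associative algebra structure on $V$ determined by $$x_ix_j := \sum_{k=1}^n c_{ij}^k x_k,\qquad c_{ij}^k\in\mathbb{C}\ (1\le i,j,k\le n),$$ corresponds the double Poisson bracket given on generators by $$\{\!\!\{x_i,x_j\}\!\!\} = \sum_{k=1}^n \left(c_{ij}^k\, x_k\otimes 1 - c_{ji}^k\, 1 \otimes x_k\right).$$
   Context: $\mathbb{C}$ denotes an algebraically closed field of characteristic $0$; $\otimes=\otimes_{\mathbb{C}}$. Associative algebra structures on $V$ are not required to have a unit. Let $A$ be an associative unital algebra. The outer bimodule structure on $A\otimes A$ is $a.(a'\otimes a'').b=(aa')\otimes(a''b)$. A double bracket on $A$ is a linear map $\{\!\!\{-,-\}\!\!\}:A\otimes A\to A\otimes A$ that is a derivation in its second argument for the outer bimodule structure and satisfies $\{\!\!\{a,b\}\!\!\}=-\{\!\!\{b,a\}\!\!\}^{o}$, where $(u\otimes v)^o=v\otimes u$. With Sweedler notation $\{\!\!\{a,b\}\!\!\}=\sum\{\!\!\{a,b\}\!\!\}'\otimes\{\!\!\{a,b\}\!\!\}''$, it is a double Poisson bracket if for all $a,b,c\in A$ $$\{\!\!\{a,\{\!\!\{b,c\}\!\!\}'\}\!\!\}\otimes\{\!\!\{b,c\}\!\!\}''+\{\!\!\{c,a\}\!\!\}''\otimes\{\!\!\{b,\{\!\!\{c,a\}\!\!\}'\}\!\!\}+\{\!\!\{c,\{\!\!\{a,b\}\!\!\}'\}\!\!\}''\otimes\{\!\!\{a,b\}\!\!\}''\otimes\{\!\!\{c,\{\!\!\{a,b\}\!\!\}'\}\!\!\}'=0.$$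 Let $A=\mathbb{C}\langle x_1,\dots,x_n\rangle$. A double derivation of $A$ is a derivation $A\to A\otimes A$ for the outer bimodule structure; double derivations form an $A$-bimodule via the inner structure: $(a\delta b)(c)=\delta(c)'b\otimes a\delta(c)''$. Let $\frac{\partial}{\partial x_i}$ be the double derivation with $\frac{\partial}{\partial x_i}(x_j)=\delta_{ij}\,1\otimes 1$. A product $\delta\Delta$ of two double derivations determines the double bracket $\{\!\!\{a,b\}\!\!\}_{\delta\Delta}=\big(\delta(a)'\Delta\delta(a)''\big)(b)-\big(\Delta(a)'\delta\Delta(a)''\big)(b)$, extended linearly to sums. A linear double bracket on $A$ is a double bracket determined by a tensor of the form $\sum_{i,j,k=1}^n c_{ij}^k\,x_k\frac{\partial}{\partial x_i}\frac{\partial}{\partial x_j}$ with $c_{ij}^k\in\mathbb{C}$; it is a linear double Poisson bracket if it is moreover a double Poisson bracket. *)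

(* Defs.v *)
From HB Require Import structures.
From mathcomp Require Import all_boot all_order all_algebra finmap.
From mathcomp.multinomials Require Export monalg.

Set Implicit Arguments.
Unset Strict Implicit.
Unset Printing Implicit Defensive.

Import GRing.Theory.
Local Open Scope ring_scope.

Reserved Notation "a ⊗ b" (at level 38, left associativity).

(* {malg C[K]} is the vector space over C with basis K; it is an associative
   unital algebra as soon as K is a monoid. *)
Section LinearExtension.
Variables (C : fieldType) (K : choiceType) (W : lmodType C).

Definition lin_ext (f : K -> W) (t : {malg C[K]}) : W :=
  \sum_(k <- msupp t) t@_k *: f k.

Lemma lin_extEw (f : K -> W) (d : {fset K}) (t : {malg C[K]}) :
  fsubset (msupp t) d -> lin_ext f t = \sum_(k <- d) t@_k *: f k.
Proof.
move=> sd; rewrite /lin_ext; apply: (big_fset_incl _ sd) => k _ /mcoeff_outdom->.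
by rewrite scale0r.
Qed.

Lemma lin_ext_linear (f : K -> W) : linear (lin_ext f).
Proof.
move=> a s t; set d := fsetU (msupp s) (msupp t).
have sd : fsubset (msupp s) d by apply: fsubsetUl.
have td : fsubset (msupp t) d by apply: fsubsetUr.
have std : fsubset (msupp (a *: s + t)) d.
  apply: fsubset_trans (msuppD_le _ _) _; apply: fsetSU; exact: msuppZ_le.
rewrite (lin_extEw _ std) (lin_extEw _ sd) (lin_extEw _ td).
rewrite scaler_sumr -big_split /=; apply: eq_bigr => k _.
by rewrite mcoeffD mcoeffZ scalerDl scalerA.
Qed.

HB.instance Definition _ (f : K -> W) :=
  GRing.isLinear.Build C {malg C[K]} W *:%R (lin_ext f) (lin_ext_linear f).

Lemma lin_extU (f : K -> W) (k : K) : lin_ext f << k >> = f k.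
Proof.
by rewrite /lin_ext msuppU oner_eq0 big_seq_fset1 mcoeffUU scale1r.
Qed.

Lemma eq_lin (f g : {linear {malg C[K]} -> W}) :
  (forall k : K, f << k >> = g << k >>) -> f =1 g.
Proof.
move=> fg t; rewrite [t]monalgE !linear_sum; apply: eq_bigr => k _.
have -> : << t@_k *g k >> = t@_k *: << k >> :> {malg C[K]}.
  by apply/malgP => k'; rewrite mcoeffZ !mcoeffU mulrnAr mulr1.
by rewrite !linearZ fg.
Qed.

Lemma eq_linear (f g : {malg C[K]} -> W) : linear f -> linear g ->
  (forall k : K, f << k >> = g << k >>) -> f =1 g.
Proof.
move=> fl gl.
pose f' : {linear {malg C[K]} -> W} :=
  HB.pack f (GRing.isLinear.Build _ _ _ *:%R _ fl).
pose g' : {linear {malg C[K]} -> W} :=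
  HB.pack g (GRing.isLinear.Build _ _ _ *:%R _ gl).
exact: (@eq_lin f' g').
Qed.

End LinearExtension.

(* {malg C[(K * L)%type]} is the tensor product of {malg C[K]} and {malg C[L]}, a pair
   (k, l) of basis elements standing for k ⊗ l; see sweedlerP. *)
Section Tensor.
Variable C : fieldType.

Definition tens (K L : choiceType) (a : {malg C[K]}) (b : {malg C[L]}) :
    {malg C[(K * L)%type]} :=
  lin_ext (fun k => lin_ext (fun l => << (k, l) >> : {malg C[(K * L)%type]}) b) a.

(* sweedler t f is the Sweedler-notation expression f(t', t''), for bilinear f *)
Definition sweedler (K L : choiceType) (W : lmodType C)
    (t : {malg C[(K * L)%type]}) (f : {malg C[K]} -> {malg C[L]} -> W) : W :=
  lin_ext (fun kl : K * L => f << kl.1 >> << kl.2 >>) t.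

End Tensor.

Arguments lin_ext {C K W} f t.
Arguments tens {C K L} a b.
Arguments sweedler {C K L W} t f.

Notation "a ⊗ b" := (tens a b) : ring_scope.

Section TensorTheory.
Variables (C : fieldType) (K L : choiceType).

Lemma tensUU (k : K) (l : L) :
  << k >> ⊗ << l >> = << (k, l) >> :> {malg C[(K * L)%type]}.
Proof. by rewrite /tens !lin_extU. Qed.

Lemma tens_linearl (b : {malg C[L]}) : linear (fun a : {malg C[K]} => a ⊗ b).
Proof. exact: lin_ext_linear. Qed.

Lemma tens_linearr (a : {malg C[K]}) : linear (fun b : {malg C[L]} => a ⊗ b).
Proof.
move=> c b b'; rewrite /tens ![lin_ext _ a]/lin_ext scaler_sumr -big_split /=.
apply: eq_bigr => k _; rewrite lin_ext_linear.
by rewrite scalerDr !scalerA mulrC.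
Qed.

Lemma sweedlerP (W : lmodType C) (f : {malg C[K]} -> {malg C[L]} -> W) :
  (forall b, linear (f^~ b)) -> (forall a, linear (f a)) ->
  [/\ linear (sweedler^~ f),
      forall a b, sweedler (a ⊗ b) f = f a b
    & forall g : {malg C[(K * L)%type]} -> W, linear g ->
        (forall a b, g (a ⊗ b) = f a b) -> g =1 sweedler^~ f].
Proof.
move=> fl fr; split; first exact: lin_ext_linear.
- move=> a b; pose h := lin_ext (fun kl : K * L => f << kl.1 >> << kl.2 >>).
  have hl : linear h by apply: lin_ext_linear.
  move: a; apply: (eq_linear _ (fl b)) => [c a a'|k].
    by rewrite (tens_linearl b); apply: hl.
  move: b; apply: (eq_linear _ (fr << k >>)) => [c b b'|l].
    by rewrite (tens_linearr << k >>); apply: hl.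
  by rewrite tensUU; apply: lin_extU.
- move=> g gl gE; apply: (eq_linear gl) => [|[k l]]; first exact: lin_ext_linear.
  by rewrite /sweedler lin_extU -tensUU gE.
Qed.

Lemma sweedler_linear (U W : lmodType C) (t : {malg C[(K * L)%type]})
    (f : U -> {malg C[K]} -> {malg C[L]} -> W) :
  (forall a b, linear (fun u => f u a b)) ->
  linear (fun u => sweedler t (f u)).
Proof.
move=> fl c u u'; rewrite /sweedler /lin_ext scaler_sumr -big_split /=.
by apply: eq_bigr => kl _; rewrite fl scalerDr !scalerA mulrC.
Qed.

End TensorTheory.

Notation free_alg C n := {malg C[{fmonom 'I_n}]}.
Notation free_alg2 C n := {malg C[({fmonom 'I_n} * {fmonom 'I_n})%type]}.
Notation free_alg3 C n :=
  {malg C[({fmonom 'I_n} * {fmonom 'I_n} * {fmonom 'I_n})%type]}.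

Section DoubleBrackets.
Variables (C : fieldType) (n : nat).

Local Notation word := {fmonom 'I_n}.
Local Notation free_alg := (free_alg C n).
Local Notation free_alg2 := (free_alg2 C n).
Local Notation free_alg3 := (free_alg3 C n).

Definition gen (i : 'I_n) : free_alg := << fmu i >>.

Definition flip (t : free_alg2) : free_alg2 := sweedler t (fun u v => v ⊗ u).

Definition outer (a : free_alg) (t : free_alg2) (b : free_alg) : free_alg2 :=
  sweedler t (fun u v => (a * u) ⊗ (v * b)).

Definition double_derivation (d : free_alg -> free_alg2) : Prop :=
  linear d /\ forall a b, d (a * b) = outer a (d b) 1 + outer 1 (d a) b.

Definition inner (a : free_alg) (d : free_alg -> free_alg2) (b : free_alg) :
    free_alg -> free_alg2 :=
  fun c => sweedler (d c) (fun u v => (u * b) ⊗ (a * v)).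

(* The sum of all w' ⊗ w'' over the factorizations w = w' x_i w''; its linear
   extension is the double derivation d/dx_i by partialP. *)
Definition partial_word (i : 'I_n) (w : word) : free_alg2 :=
  \sum_(p < size w | tnth (in_tuple w) p == i)
    << (FMonom (take p w), FMonom (drop p.+1 w)) >>.

Definition partial (i : 'I_n) : free_alg -> free_alg2 :=
  lin_ext (partial_word i).

Lemma malgUM (u v : word) : << u >> * << v >> = << mmul u v >> :> free_alg.
Proof. by rewrite malgM_def fgmulUU mulr1. Qed.

Lemma malg_scalerAr (c : C) (a b : free_alg) : a * (c *: b) = c *: (a * b).
Proof.
rewrite (malgMEw (fsubset_refl (msupp a)) (msuppZ_le c b)) malgME scaler_sumr.
apply: eq_bigr => u _; rewrite scaler_sumr; apply: eq_bigr => v _.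
by apply/malgP => w; rewrite !(mcoeffZ, mcoeffU) mulrCA mulrnAr.
Qed.

Lemma outerU (x u v y : word) :
  outer << x >> << (u, v) >> << y >> = << (mmul x u, mmul v y) >>.
Proof. by rewrite /outer /sweedler lin_extU /= !malgUM tensUU. Qed.

Lemma outer_linear a b : linear (fun t => outer a t b).
Proof. exact: lin_ext_linear. Qed.

Lemma outer_sum a b (I : Type) (r : seq I) (P : pred I) (F : I -> free_alg2) :
  outer a (\sum_(p <- r | P p) F p) b = \sum_(p <- r | P p) outer a (F p) b.
Proof.
pose oM : {linear free_alg2 -> free_alg2} := HB.pack (fun t => outer a t b)
  (GRing.isLinear.Build _ _ _ *:%R _ (outer_linear a b)).
exact: (linear_sum oM).
Qed.

Lemma outer_linearl t b : linear (fun a => outer a t b).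
Proof.
apply: sweedler_linear => u v c a a'.
by rewrite mulrDl -scalerAl tens_linearl.
Qed.

Lemma outer_linearr a t : linear (fun b => outer a t b).
Proof.
apply: sweedler_linear => u v c b b'.
by rewrite mulrDr malg_scalerAr tens_linearr.
Qed.

Lemma partial_wordE (i : 'I_n) (w : word) : partial_word i w =
  \sum_(0 <= p < size w | nth i w p == i)
    << (FMonom (take p w), FMonom (drop p.+1 w)) >>.
Proof.
by rewrite big_mkord; apply: eq_bigl => p; rewrite (tnth_nth i).
Qed.

Lemma partialM i : double_derivation (partial i).
Proof.
split; first exact: lin_ext_linear.
have PL := lin_ext_linear (partial_word i).
move=> a b; move: a; apply: eq_linear => [c a a'|c a a'|u].
- by rewrite mulrDl -scalerAl /partial PL.
- rewrite outer_linearl /partial PL outer_linear.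
  by rewrite scalerDr -!addrA; congr (_ + _); rewrite addrCA.
move: b; apply: eq_linear => [c a a'|c a a'|v].
- by rewrite mulrDr malg_scalerAr /partial PL.
- rewrite outer_linearr /partial PL outer_linear.
  by rewrite scalerDr -!addrA; congr (_ + _); rewrite addrCA.
rewrite malgUM /partial !lin_extU !partial_wordE.
rewrite !outer_sum fmM size_cat (big_cat_nat (n := size u)) ?leq_addr //=.
rewrite addrC; congr (_ + _).
  rewrite -{1}[size u]add0n [X in \sum_(_ <= _ < X | _) _]addnC big_addn addnK.
  apply: congr_big_nat => // [p|p /andP[_ /andP[_ ltp]]].
    by move=> _; rewrite nth_cat ltnNge leq_addl addnK.
  rewrite outerU; congr << (_, _) >>; apply: val_inj.
    by rewrite [RHS]fmM /= take_cat ltnNge leq_addl addnK.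
  rewrite [RHS]fmM fm1 cats0 /= drop_cat ltnNge ltnW ?ltnS ?leq_addl //=.
  by rewrite -addSn addnK.
apply: congr_big_nat => // [p /andP[_ ltp]|p /andP[_ /andP[_ ltp]]].
  by rewrite nth_cat ltp.
rewrite outerU; congr << (_, _) >>; apply: val_inj.
  by rewrite [RHS]fmM fm1 /= take_cat ltp.
rewrite [RHS]fmM /= drop_cat; case: ltnP => // le_up.
have -> : p.+1 = size u by apply/eqP; rewrite eqn_leq ltp.
by rewrite subnn drop0 drop_size.
Qed.

Lemma double_derivation1 d : double_derivation d -> d 1 = 0.
Proof.
case=> _ dM; have := dM 1 1; rewrite mulr1.
have -> t : outer 1 t 1 = t.
  move: t; apply: eq_linear => [|//|[u v]]; first exact: outer_linear.
  by rewrite outerU mul1m mulm1.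
by move/eqP; rewrite -subr_eq subrr => /eqP.
Qed.

Lemma partialP (i : 'I_n) :
  [/\ double_derivation (partial i),
      forall j, partial i (gen j) = if i == j then 1 ⊗ 1 else 0
    & forall d, double_derivation d ->
        (forall j, d (gen j) = if i == j then 1 ⊗ 1 else 0) -> d =1 partial i].
Proof.
have gE j : partial i (gen j) = if i == j then 1 ⊗ 1 else 0.
  rewrite /partial lin_extU partial_wordE fmU /=.
  rewrite big_mkcond big_nat1 /= eq_sym; case: eqP => // _.
  by rewrite tensUU; congr << (_, _) >>; apply: val_inj; rewrite /= fm1.
split=> // [|d dd dE]; first exact: partialM.
apply: eq_linear => [||w]; [exact: dd.1 | exact: (partialM i).1 | ].
have [s ->] : exists s, w = FMonom s by exists w; rewrite fmK.
elim: s => [|j s IHs].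
  have -> : << FMonom [::] >> = 1 :> free_alg.
    by congr << _ >>; apply: val_inj; rewrite /= fm1.
  by rewrite (double_derivation1 dd) (double_derivation1 (partialM i)).
have -> : << FMonom (j :: s) >> = gen j * << FMonom s >> :> free_alg.
  by rewrite malgUM; congr << _ >>; apply: val_inj; rewrite /= fmM fmU.
by rewrite dd.2 (partialM i).2 dE gE IHs.
Qed.

(* A bracket is a linear map on free_alg2; {{a, b}} is br (a ⊗ b). *)
Definition double_bracket (br : free_alg2 -> free_alg2) : Prop :=
  [/\ linear br,
      forall a, double_derivation (fun b => br (a ⊗ b))
    & forall a b, br (a ⊗ b) = - flip (br (b ⊗ a))].

Definition double_jacobiator (br : free_alg2 -> free_alg2) (a b c : free_alg) :
    free_alg3 :=
    sweedler (br (b ⊗ c)) (fun u v =>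
      sweedler (br (a ⊗ u)) (fun p q => p ⊗ q ⊗ v))
  + sweedler (br (c ⊗ a)) (fun u v =>
      sweedler (br (b ⊗ u)) (fun p q => v ⊗ p ⊗ q))
  + sweedler (br (a ⊗ b)) (fun u v =>
      sweedler (br (c ⊗ u)) (fun p q => q ⊗ v ⊗ p)).

Definition double_poisson_bracket (br : free_alg2 -> free_alg2) : Prop :=
  double_bracket br /\ forall a b c, double_jacobiator br a b c = 0.

(* {{a, b}} for the product d1 d2 of two double derivations *)
Definition prod_bracket (d1 d2 : free_alg -> free_alg2) (a b : free_alg) :
    free_alg2 :=
    sweedler (d1 a) (fun u v => inner u d2 v b)
  - sweedler (d2 a) (fun u v => inner u d1 v b).

Definition linear_double_bracket (br : free_alg2 -> free_alg2) : Prop :=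
  double_bracket br /\
  exists c : 'I_n -> 'I_n -> 'I_n -> C, forall a b,
    br (a ⊗ b) = \sum_(i < n) \sum_(j < n) \sum_(k < n)
      c i j k *: prod_bracket (inner (gen k) (partial i) 1) (partial j) a b.

Definition linear_double_poisson_bracket (br : free_alg2 -> free_alg2) : Prop :=
  linear_double_bracket br /\ double_poisson_bracket br.

End DoubleBrackets.

Arguments gen {C n} i.

(* mul is not required to have a unit. *)
Definition assoc_alg_structure (C : fieldType) (V : lmodType C)
    (mul : V -> V -> V) : Prop :=
  [/\ forall v, linear (mul^~ v), forall u, linear (mul u) & associative mul].

(* Main.v *)
From HB Require Import structures.
Require Import Defs.
From mathcomp Require Import all_boot all_order all_algebra.
From mathcomp Require Import boolp.

Set Implicit Arguments.
Unset Strict Implicit.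
Unset Printing Implicit Defensive.

Import GRing.Theory.
Local Open Scope ring_scope.

(** Write V for the span of the generators, embedded in the free algebra A.
    The tensor with coefficients c determines on generators the bracket
    {{x, y}} = xy (x) 1 - 1 (x) yx, where xy is the product on V with structure
    constants c (linear_bracket_gen, linear_bracket_embV).  The constants can be
    read off from these values (linear_bracketK), so linear double brackets and
    bilinear products on V are both parametrized by the constants c, and the
    point is that the Jacobi identity of the bracket is the associativity of the
    product.

    Since {{a, 1}} = 0, the three summands of the triple bracket on x, y, z in V
    are
      x(yz) (x) 1 (x) 1 - 1 (x) (yz)x (x) 1,
      1 (x) y(zx) (x) 1 - 1 (x) 1 (x) (zx)y,
      1 (x) 1 (x) z(xy) - (xy)z (x) 1 (x) 1,
    so their sum carries one associator of the product in each tensor slot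
    (double_jacobiator_embV).  It vanishes on V exactly when the product is
    associative.

    It remains to pass from V to A.  The triple bracket of any double bracket is
    a derivation in its last argument (double_jacobiatorM) and is invariant
    under simultaneous rotation of its arguments and of the tensor slots
    (double_jacobiator_rot).  Hence it vanishes identically once it vanishes on
    generators (double_jacobiator_eq0).

    That the tensor with arbitrary coefficients c gives a double bracket at all
    is a property of products of two double derivations: the bracket of such a
    product is a double derivation in its second argument and is antisymmetric
    (prod_bracket_derivation, prod_bracket_antisym).

    Identities between Sweedler sums are checked on words: a Sweedler sum is
    linear in its tensor whatever the summand, and on a pair of words it is the
    value of the summand (sweedlerU, eq_sweedler).  No bilinearity has to be
    proved as long as all tensor factors stay words. *)

(** * Linearity and the Sweedler calculus *)

(** The brackets are unbundled functions with a proof of linearity, so the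
    additive lemmas are restated for these. *)
Section LinearMaps.
Variables (C : fieldType) (U V : lmodType C) (g : U -> V).
Hypothesis gl : linear g.

Let g' : {linear U -> V} :=
  HB.pack g (GRing.isLinear.Build _ _ _ *:%R _ gl).

Lemma linear_map0 : g 0 = 0.
Proof. exact: (linear0 g'). Qed.

Lemma linear_mapD x y : g (x + y) = g x + g y.
Proof. exact: (linearD g'). Qed.

Lemma linear_mapB x y : g (x - y) = g x - g y.
Proof. exact: (linearB g'). Qed.

Lemma linear_mapN x : g (- x) = - g x.
Proof. exact: (linearN g'). Qed.

Lemma linear_mapZ c x : g (c *: x) = c *: g x.
Proof. exact: (linearZ_LR g'). Qed.

Lemma linear_map_sum I (r : seq I) (P : pred I) (E : I -> U) :
  g (\sum_(i <- r | P i) E i) = \sum_(i <- r | P i) g (E i).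
Proof. exact: (linear_sum g'). Qed.

End LinearMaps.

Section LinearCombinations.
Variables (C : fieldType) (U V W : lmodType C).

Lemma linear_comp (g : V -> W) (f : U -> V) :
  linear g -> linear f -> linear (g \o f).
Proof. by move=> gl fl c x y; rewrite /= fl gl. Qed.

Lemma linear_add (f g : U -> V) :
  linear f -> linear g -> linear (fun x => f x + g x).
Proof. by move=> fl gl c x y; rewrite fl gl scalerDr addrACA. Qed.

Lemma linear_opp (f : U -> V) : linear f -> linear (fun x => - f x).
Proof. by move=> fl c x y; rewrite fl opprD scalerN. Qed.

Lemma linear_scale (a : C) (f : U -> V) :
  linear f -> linear (fun x => a *: f x).
Proof. by move=> fl c x y; rewrite fl scalerDr !scalerA mulrC. Qed.

Lemma linear_sum_fun I (r : seq I) (P : pred I) (f : I -> U -> V) :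
  (forall i, linear (f i)) -> linear (fun x => \sum_(i <- r | P i) f i x).
Proof.
move=> fl c x y; rewrite scaler_sumr -big_split /=.
by apply: eq_bigr => i _; rewrite fl.
Qed.

End LinearCombinations.

Section Sweedler.
Variables (C : fieldType) (K L : choiceType) (W : lmodType C).
Implicit Types (f : {malg C[K]} -> {malg C[L]} -> W).
Implicit Types (t : {malg C[(K * L)%type]}).

Lemma sweedlerU k l f : sweedler << (k, l) >> f = f << k >> << l >>.
Proof. exact: lin_extU. Qed.

Lemma sweedler_linearl f : linear (fun t => sweedler t f).
Proof. exact: lin_ext_linear. Qed.

Lemma sweedlerZ c t f : sweedler (c *: t) f = c *: sweedler t f.
Proof. exact: (linear_mapZ (sweedler_linearl f)). Qed.

(** A Sweedler sum evaluates its summand at pairs of basis elements only, which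
    makes agreement there enough for summands that are not bilinear. *)
Lemma eq_sweedler t f f' :
  (forall k l, f << k >> << l >> = f' << k >> << l >>) ->
  sweedler t f = sweedler t f'.
Proof. by move=> ff'; apply: eq_bigr => -[k l] _; rewrite ff'. Qed.

Lemma linear_sweedler (W' : lmodType C) (g : W -> W') t f :
  linear g -> g (sweedler t f) = sweedler t (fun u v => g (f u v)).
Proof.
move=> gl; rewrite /sweedler /lin_ext (linear_map_sum gl).
by apply: eq_bigr => kl _; rewrite (linear_mapZ gl).
Qed.

Lemma sweedlerD t f f' :
  sweedler t (fun u v => f u v + f' u v) = sweedler t f + sweedler t f'.
Proof.
by rewrite /sweedler /lin_ext -big_split; apply: eq_bigr => kl _;
  rewrite scalerDr.
Qed.

Lemma sweedlerT f a b :
  (forall b, linear (f^~ b)) -> (forall a, linear (f a)) ->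
  sweedler (a ⊗ b) f = f a b.
Proof. by move=> fl fr; have [_ ->] := sweedlerP fl fr. Qed.

End Sweedler.

Section SweedlerExchange.
Variables (C : fieldType) (K L K' L' : choiceType) (W : lmodType C).

Lemma exchange_sweedler (t : {malg C[(K * L)%type]})
    (s : {malg C[(K' * L')%type]}) (F : _ -> _ -> _ -> _ -> W) :
  sweedler t (fun u v => sweedler s (fun p q => F u v p q)) =
  sweedler s (fun p q => sweedler t (fun u v => F u v p q)).
Proof.
rewrite (linear_sweedler (g := fun x => x) _ _) // /sweedler /lin_ext.
under eq_bigr do rewrite scaler_sumr.
rewrite exchange_big; apply: eq_bigr => kl _ /=; rewrite scaler_sumr.
by apply: eq_bigr => kl' _; rewrite !scalerA mulrC.
Qed.

Lemma sweedler_sweedler (t : {malg C[(K * L)%type]})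
    (h : _ -> _ -> {malg C[(K' * L')%type]}) (F : _ -> _ -> W) :
  sweedler (sweedler t h) F = sweedler t (fun u v => sweedler (h u v) F).
Proof. by rewrite (linear_sweedler t h (sweedler_linearl F)). Qed.

End SweedlerExchange.

(** * Double derivations of the free algebra *)

Section FreeAlgebra.
Variables (C : fieldType) (n : nat).
Local Notation word := {fmonom 'I_n}.
Local Notation A := (free_alg C n).
Local Notation A2 := (free_alg2 C n).

Lemma mul_linearl (b : A) : linear (fun a : A => a * b).
Proof. by move=> c a a'; rewrite mulrDl -scalerAl. Qed.

Lemma mul_linearr (a : A) : linear (fun b : A => a * b).
Proof. by move=> c b b'; rewrite mulrDr malg_scalerAr. Qed.

Lemma word_ind (P : word -> Prop) :
  P (@mone word) -> (forall i w, P w -> P (mmul (fmu i) w)) -> forall w, P w.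
Proof.
move=> P1 PM w; have [s ->] : exists s, w = FMonom s by exists w; rewrite fmK.
elim: s => [|i s IHs].
  by have -> : FMonom [::] = @mone word by apply: val_inj; rewrite /= fm1.
have -> : FMonom (i :: s) = mmul (fmu i) (FMonom s).
  by apply: val_inj; rewrite /= fmM fmU.
exact: PM.
Qed.

Lemma outerT (x u v y : A) : outer x (u ⊗ v) y = (x * u) ⊗ (v * y).
Proof.
rewrite /outer sweedlerT // => [b|a].
  exact: (linear_comp (tens_linearl _) (mul_linearr _)).
exact: (linear_comp (tens_linearr _) (mul_linearl _)).
Qed.

(** The inner bimodule structure of the tensor square. *)
Definition inner_act (x : A) (t : A2) (y : A) : A2 :=
  sweedler t (fun u v => (u * y) ⊗ (x * v)).

Lemma inner_act_linear (x y : A) : linear (fun t => inner_act x t y).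
Proof. exact: sweedler_linearl. Qed.

Lemma inner_actT (x u v y : A) :
  inner_act x (u ⊗ v) y = (u * y) ⊗ (x * v).
Proof.
rewrite /inner_act sweedlerT // => [b|a].
  exact: (linear_comp (tens_linearl _) (mul_linearl _)).
exact: (linear_comp (tens_linearr _) (mul_linearr _)).
Qed.

Lemma eq_tensor (W : lmodType C) (f g : A2 -> W) : linear f -> linear g ->
  (forall u v : A, f (u ⊗ v) = g (u ⊗ v)) -> f =1 g.
Proof.
by move=> fl gl fg; apply: eq_linear => // -[u v]; rewrite -tensUU.
Qed.

Lemma double_derivation_comp (g : A2 -> A2) (d : A -> A2) : linear g ->
  (forall a t b, g (outer a t b) = outer a (g t) b) ->
  double_derivation d -> double_derivation (g \o d).
Proof.
move=> gl gE [dl dM]; split; first exact: linear_comp.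
by move=> a b; rewrite /= dM (linear_mapD gl) [X in X + _]gE [X in _ + X]gE.
Qed.

(** The inner and the outer bimodule structures commute, so the inner action
    preserves the Leibniz rule, which only involves the outer one. *)
Lemma inner_double_derivation d (x y : A) :
  double_derivation d -> double_derivation (inner x d y).
Proof.
apply: (double_derivation_comp (inner_act_linear x y)) => a t b.
move: t; apply: eq_tensor => [||u v].
- exact: (linear_comp (inner_act_linear _ _) (outer_linear _ _)).
- exact: (linear_comp (outer_linear _ _) (inner_act_linear _ _)).
rewrite [X in inner_act _ X _]outerT [LHS]inner_actT.
by rewrite [X in outer _ X _]inner_actT [RHS]outerT mulrA mulrA.
Qed.

Lemma double_derivation_sub d d' : double_derivation d ->
  double_derivation d' -> double_derivation (fun a : A => d a - d' a : A2).
Proof.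
case=> dl dM [dl' dM']; split.
  exact: (linear_add dl (linear_opp dl')).
move=> a b; rewrite dM dM' !(linear_mapB (outer_linear _ _)).
by rewrite opprD addrACA.
Qed.

Lemma double_derivation_scale (c : C) d :
  double_derivation d -> double_derivation (fun a : A => c *: d a : A2).
Proof.
case=> dl dM; split; first exact: linear_scale.
by move=> a b; rewrite dM !(linear_mapZ (outer_linear _ _)) scalerDr.
Qed.

Lemma double_derivation_sum I (r : seq I) (d : I -> A -> A2) :
  (forall i, double_derivation (d i)) ->
  double_derivation (fun a => \sum_(i <- r) d i a).
Proof.
move=> dP; split; first by apply: linear_sum_fun => i; exact: (dP i).1.
move=> a b; rewrite !(linear_map_sum (outer_linear _ _)) -big_split.
by apply: eq_bigr => i _; rewrite (dP i).2.
Qed.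

Lemma sweedler_double_derivation t (d : A -> A -> A -> A2) :
  (forall u v, double_derivation (d u v)) ->
  double_derivation (fun b => sweedler t (fun u v => d u v b)).
Proof.
move=> dP; split; first by apply: sweedler_linear => u v; exact: (dP u v).1.
move=> a b; rewrite !(linear_sweedler _ _ (outer_linear _ _)) -sweedlerD.
by apply: eq_sweedler => u v; rewrite (dP _ _).2.
Qed.

Lemma flip_linear : linear (@flip C n).
Proof. exact: sweedler_linearl. Qed.

Lemma flipT (u v : A) : flip (u ⊗ v) = v ⊗ u.
Proof.
rewrite /flip sweedlerT // => [b|a]; [exact: tens_linearr|exact: tens_linearl].
Qed.

(** * The bracket of a product of two double derivations *)

Section ProdBracket.
Variables d1 d2 : A -> A2.

(** Exchanging the two Sweedler sums turns each of the two terms of the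
    bracket into the flip of the other one with the arguments exchanged. *)
Lemma prod_bracket_antisym a b :
  prod_bracket d1 d2 a b = - flip (prod_bracket d1 d2 b a).
Proof.
have E d d' x y : flip (sweedler (d x) (fun u v => inner u d' v y)) =
    sweedler (d' y) (fun u v => inner u d v x) :> A2.
  etransitivity; first exact: (linear_sweedler (d x) _ flip_linear).
  etransitivity; last exact: (exchange_sweedler (d x) (d' y)
    (fun u v p q => (u * q) ⊗ (p * v))).
  apply: eq_sweedler => k l.
  etransitivity; first exact: (linear_sweedler (d' y) _ flip_linear).
  apply: eq_sweedler => p q; exact: flipT.
rewrite /prod_bracket (linear_mapB flip_linear).
rewrite opprB -[X in X - _ = _](E d2 d1 b a) -[X in _ - X = _](E d1 d2 b a).
by [].
Qed.

Hypotheses (d1P : double_derivation d1) (d2P : double_derivation d2).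

Lemma prod_bracket_linearl b : linear (fun a => prod_bracket d1 d2 a b).
Proof.
apply: linear_add; last apply: linear_opp.
  exact: linear_comp (sweedler_linearl _) d1P.1.
exact: linear_comp (sweedler_linearl _) d2P.1.
Qed.

Lemma prod_bracket_derivation a : double_derivation (prod_bracket d1 d2 a).
Proof.
apply: double_derivation_sub; apply: sweedler_double_derivation => u v;
  exact: inner_double_derivation.
Qed.

End ProdBracket.

End FreeAlgebra.

(** * The double Jacobiator *)

Section Jacobiator.
Variables (C : fieldType) (n : nat).
Local Notation word := {fmonom 'I_n}.
Local Notation A := (free_alg C n).
Local Notation A2 := (free_alg2 C n).
Local Notation A3 := (free_alg3 C n).

(** When x and y are words, so are both factors of the result; this replaces
    the bilinearity of F. *)
Lemma sweedler_outer (W : lmodType C) (x y : word) (t : A2) (F : A -> A -> W) :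
  sweedler (outer << x >> t << y >>) F =
  sweedler t (fun p q => F (<< x >> * p) (q * << y >>)).
Proof.
etransitivity; first exact: sweedler_sweedler.
by apply: eq_sweedler => k l; rewrite !malgUM tensUU sweedlerU.
Qed.

Lemma sweedler_flip (W : lmodType C) (t : A2) (F : A -> A -> W) :
  sweedler (flip t) F = sweedler t (fun p q => F q p).
Proof.
etransitivity; first exact: sweedler_sweedler.
by apply: eq_sweedler => k l; rewrite tensUU sweedlerU.
Qed.

(** The outer bimodule structure of the tensor cube. *)
Definition lmul3 (w : word) : A3 -> A3 :=
  lin_ext (fun k => << ((mmul w k.1.1, k.1.2), k.2) >>).

Definition rmul3 (w : word) : A3 -> A3 :=
  lin_ext (fun k => << ((k.1.1, k.1.2), mmul k.2 w) >>).

Definition rot3 : A3 -> A3 := lin_ext (fun k => << ((k.2, k.1.1), k.1.2) >>).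

Lemma lmul3_linear w : linear (lmul3 w).
Proof. exact: lin_ext_linear. Qed.

Lemma rmul3_linear w : linear (rmul3 w).
Proof. exact: lin_ext_linear. Qed.

Lemma rot3_linear : linear rot3.
Proof. exact: lin_ext_linear. Qed.

Lemma tens3U (p q r : word) :
  << p >> ⊗ << q >> ⊗ << r >> = << ((p, q), r) >> :> A3.
Proof. by rewrite tensUU tensUU. Qed.

Lemma lmul3T w (p q r : word) :
  lmul3 w (<< p >> ⊗ << q >> ⊗ << r >>) =
    (<< w >> * << p >>) ⊗ << q >> ⊗ << r >>.
Proof. by rewrite [X in lmul3 w X]tens3U malgUM [RHS]tens3U /lmul3 lin_extU. Qed.

Lemma rmul3T w (p q r : word) :
  rmul3 w (<< p >> ⊗ << q >> ⊗ << r >>) =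
    << p >> ⊗ << q >> ⊗ (<< r >> * << w >>).
Proof. by rewrite [X in rmul3 w X]tens3U malgUM [RHS]tens3U /rmul3 lin_extU. Qed.

Lemma rot3T (p q r : word) :
  rot3 (<< p >> ⊗ << q >> ⊗ << r >>) = << r >> ⊗ << p >> ⊗ << q >> :> A3.
Proof. by rewrite [X in rot3 X]tens3U [RHS]tens3U /rot3 lin_extU. Qed.

Variable br : A2 -> A2.
Hypothesis brP : double_bracket br.

Let br_linear : linear br. Proof. by case: brP. Qed.

Lemma bracket_linearl b : linear (fun a => br (a ⊗ b)).
Proof. exact: (linear_comp br_linear (tens_linearl b)). Qed.

Lemma bracket_linearr a : linear (fun b => br (a ⊗ b)).
Proof. exact: (linear_comp br_linear (tens_linearr a)). Qed.

Lemma bracketx1 a : br (a ⊗ 1) = 0.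
Proof. by case: brP => _ /(_ a) /double_derivation1. Qed.

Lemma sweedler_bracketN (W : lmodType C) a b (F : A -> A -> W) :
  sweedler (br (a ⊗ b)) F = - sweedler (br (b ⊗ a)) (fun p q => F q p).
Proof.
case: brP => _ _ brN; rewrite [X in sweedler X _ = _](brN a b).
by rewrite (linear_mapN (sweedler_linearl F)) [X in - X = _]sweedler_flip.
Qed.

Lemma sweedler_bracketMr (W : lmodType C) a (c d : word) (F : A -> A -> W) :
  sweedler (br (a ⊗ (<< c >> * << d >>))) F =
    sweedler (br (a ⊗ << d >>)) (fun p q => F (<< c >> * p) q) +
    sweedler (br (a ⊗ << c >>)) (fun p q => F p (q * << d >>)).
Proof.
case: brP => _ /(_ a) [_ brM] _; rewrite [X in sweedler X _ = _](brM _ _).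
rewrite (linear_mapD (sweedler_linearl F)).
rewrite [X in X + _ = _]sweedler_outer [X in _ + X = _]sweedler_outer.
rewrite [X in X + _ = _](eq_sweedler _ (f' := fun p q => F (<< c >> * p) q)).
  rewrite [X in _ + X = _](eq_sweedler _ (f' := fun p q => F p (q * << d >>))) //.
  by move=> k l; rewrite mul1r.
by move=> k l; rewrite mulr1.
Qed.

(** By antisymmetry the Leibniz rule in the first argument uses the inner
    bimodule structure. *)
Lemma sweedler_bracketMl (W : lmodType C) a (c d : word) (F : A -> A -> W) :
  sweedler (br ((<< c >> * << d >>) ⊗ a)) F =
    sweedler (br (<< d >> ⊗ a)) (fun p q => F p (<< c >> * q)) +
    sweedler (br (<< c >> ⊗ a)) (fun p q => F (p * << d >>) q).
Proof.
rewrite [LHS]sweedler_bracketN [X in - X]sweedler_bracketMr opprD.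
by rewrite -[X in X + _ = _]sweedler_bracketN -[X in _ + X = _]sweedler_bracketN.
Qed.

Lemma addr_cancel6 (V : zmodType) (l1 x r1 l2 y r2 l3 r3 : V) : y = - x ->
  (l1 + x + r1) + (l2 + (y + r2)) + (l3 + r3) =
  (l1 + l2 + l3) + (r1 + r2 + r3).
Proof.
move=> ->; rewrite [l1 + x + r1]addrAC [- x + r2]addrC [l2 + _]addrA.
by rewrite [X in X + _ = _]addrACA subrr addr0 [X in X + _ = _]addrACA [RHS]addrACA.
Qed.

Definition jacobi1 a b c : A3 := sweedler (br (b ⊗ c)) (fun u v =>
  sweedler (br (a ⊗ u)) (fun p q => p ⊗ q ⊗ v)).
Definition jacobi2 a b c : A3 := sweedler (br (c ⊗ a)) (fun u v =>
  sweedler (br (b ⊗ u)) (fun p q => v ⊗ p ⊗ q)).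
Definition jacobi3 a b c : A3 := sweedler (br (a ⊗ b)) (fun u v =>
  sweedler (br (c ⊗ u)) (fun p q => q ⊗ v ⊗ p)).

(** The term by which a summand of the triple bracket fails to be a derivation
    in its last argument. *)
Definition jacobi_defect a b c d : A3 := sweedler (br (b ⊗ d)) (fun u v =>
  sweedler (br (a ⊗ c)) (fun p q => p ⊗ (q * u) ⊗ v)).

Lemma double_jacobiatorE a b c : double_jacobiator br a b c =
  jacobi1 a b c + jacobi2 a b c + jacobi3 a b c.
Proof. by []. Qed.

Lemma jacobi1M a b (c d : word) : jacobi1 a b (<< c >> * << d >>) =
  lmul3 c (jacobi1 a b << d >>) + jacobi_defect a b << c >> << d >> +
  rmul3 d (jacobi1 a b << c >>).
Proof.
rewrite [X in _ = X + _ + _](linear_sweedler _ _ (lmul3_linear c)).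
rewrite [X in _ = _ + X](linear_sweedler _ _ (rmul3_linear d)).
rewrite -[X in _ = X + _]sweedlerD.
etransitivity; first exact: sweedler_bracketMr.
apply: f_equal2; apply: eq_sweedler => u v.
  rewrite [LHS]sweedler_bracketMr.
  rewrite [X in _ = X + _](linear_sweedler _ _ (lmul3_linear c)).
  apply: f_equal2; last by [].
  by apply: eq_sweedler => p q; rewrite [RHS]lmul3T.
rewrite [RHS](linear_sweedler _ _ (rmul3_linear d)).
by apply: eq_sweedler => p q; rewrite [RHS]rmul3T.
Qed.

Lemma jacobi2M a b (c d : word) : jacobi2 a b (<< c >> * << d >>) =
  lmul3 c (jacobi2 a b << d >>) + (- jacobi_defect a b << c >> << d >> +
  rmul3 d (jacobi2 a b << c >>)).
Proof.
have -> : - jacobi_defect a b << c >> << d >> =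
    sweedler (br (<< c >> ⊗ a)) (fun u v =>
      sweedler (br (b ⊗ << d >>)) (fun p q => v ⊗ (u * p) ⊗ q)).
  rewrite [RHS]sweedler_bracketN; apply: f_equal.
  exact: exchange_sweedler.
rewrite [X in _ = X + _](linear_sweedler _ _ (lmul3_linear c)).
rewrite [X in _ = _ + (_ + X)](linear_sweedler _ _ (rmul3_linear d)).
rewrite -[X in _ = _ + X]sweedlerD.
etransitivity; first exact: sweedler_bracketMl.
apply: f_equal2; apply: eq_sweedler => u v.
  rewrite [RHS](linear_sweedler _ _ (lmul3_linear c)).
  by apply: eq_sweedler => p q; rewrite [RHS]lmul3T.
rewrite [LHS]sweedler_bracketMr.
rewrite [X in _ = _ + X](linear_sweedler _ _ (rmul3_linear d)).
apply: f_equal2; first by [].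
by apply: eq_sweedler => p q; rewrite [RHS]rmul3T.
Qed.

Lemma jacobi3M a b (c d : word) : jacobi3 a b (<< c >> * << d >>) =
  lmul3 c (jacobi3 a b << d >>) + rmul3 d (jacobi3 a b << c >>).
Proof.
rewrite [X in _ = X + _](linear_sweedler _ _ (lmul3_linear c)).
rewrite [X in _ = _ + X](linear_sweedler _ _ (rmul3_linear d)).
rewrite -[RHS]sweedlerD; apply: eq_sweedler => u v.
rewrite [LHS]sweedler_bracketMl.
rewrite [X in _ = X + _](linear_sweedler _ _ (lmul3_linear c)).
rewrite [X in _ = _ + X](linear_sweedler _ _ (rmul3_linear d)).
apply: f_equal2; apply: eq_sweedler => p q.
  by rewrite [RHS]lmul3T.
by rewrite [RHS]rmul3T.
Qed.

(** Only the first two summands fail to be derivations for the outer bimodule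
    structure: both produce a term built from the brackets of a, c and of b, d,
    and these terms are opposite to each other by antisymmetry. *)
Lemma double_jacobiatorM a b (c d : word) :
  double_jacobiator br a b (<< c >> * << d >>) =
    lmul3 c (double_jacobiator br a b << d >>) +
    rmul3 d (double_jacobiator br a b << c >>).
Proof.
rewrite [LHS]double_jacobiatorE jacobi1M jacobi2M jacobi3M.
rewrite [X in _ = lmul3 c X + _]double_jacobiatorE
  [X in _ = _ + rmul3 d X]double_jacobiatorE.
rewrite !(linear_mapD (lmul3_linear c)) !(linear_mapD (rmul3_linear d)).
exact: addr_cancel6.
Qed.

(** Rotation permutes the three summands cyclically. *)
Lemma double_jacobiator_rot a b c :
  double_jacobiator br a b c = rot3 (double_jacobiator br b c a).
Proof.
have E s (f : A -> A -> A2) (F F' : A -> A -> A -> A3) :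
    (forall p q v : word, rot3 (F << p >> << q >> << v >>) =
       F' << p >> << q >> << v >>) ->
    rot3 (sweedler s (fun u v => sweedler (f u v) (fun p q => F p q v))) =
    sweedler s (fun u v => sweedler (f u v) (fun p q => F' p q v)).
  move=> FE; rewrite [LHS](linear_sweedler _ _ rot3_linear).
  apply: eq_sweedler => u v; rewrite [LHS](linear_sweedler _ _ rot3_linear).
  by apply: eq_sweedler => p q; exact: FE.
rewrite !double_jacobiatorE !(linear_mapD rot3_linear) -addrA [LHS]addrC.
apply: f_equal2; first apply: f_equal2.
- symmetry; apply: (E _ (fun u v => br (b ⊗ u)) (fun p q v => p ⊗ q ⊗ v)
    (fun p q v => v ⊗ p ⊗ q)) => p q v; exact: rot3T.
- symmetry; apply: (E _ (fun u v => br (c ⊗ u)) (fun p q v => v ⊗ p ⊗ q)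
    (fun p q v => q ⊗ v ⊗ p)) => p q v; exact: rot3T.
symmetry; apply: (E _ (fun u v => br (a ⊗ u)) (fun p q v => q ⊗ v ⊗ p)
  (fun p q v => p ⊗ q ⊗ v)) => p q v; exact: rot3T.
Qed.

Lemma double_jacobiator_linear a b : linear (double_jacobiator br a b).
Proof.
apply: linear_add; first apply: linear_add.
- exact: (linear_comp (sweedler_linearl _) (bracket_linearr b)).
- exact: (linear_comp (sweedler_linearl _) (bracket_linearl a)).
apply: sweedler_linear => u v.
exact: (linear_comp (sweedler_linearl _) (bracket_linearl u)).
Qed.

End Jacobiator.

Section JacobiGenerators.
Variables (C : fieldType) (n : nat) (br : free_alg2 C n -> free_alg2 C n).
Hypothesis brP : double_bracket br.
Local Notation word := {fmonom 'I_n}.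
Local Notation A := (free_alg C n).

Lemma lmul3_1 : @lmul3 C n (@mone word) =1 id.
Proof.
apply: eq_linear => [||[[p q] r]]; [exact: lmul3_linear|by []|].
by rewrite /lmul3 lin_extU mul1m.
Qed.

Lemma rmul3_1 : @rmul3 C n (@mone word) =1 id.
Proof.
apply: eq_linear => [||[[p q] r]]; [exact: rmul3_linear|by []|].
by rewrite /rmul3 lin_extU mulm1.
Qed.

(** A derivation kills the unit. *)
Lemma double_jacobiator1 a b : double_jacobiator br a b 1 = 0.
Proof.
have := double_jacobiatorM brP a b (@mone word) (@mone word).
rewrite malgUM mul1m lmul3_1 rmul3_1.
by move/eqP; rewrite -subr_eq subrr eq_sym => /eqP.
Qed.

Lemma double_jacobiator_eq0r a b :
  (forall i, double_jacobiator br a b (gen i) = 0) ->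
  forall c, double_jacobiator br a b c = 0.
Proof.
move=> J0; apply: eq_linear => [||w]; first exact: double_jacobiator_linear.
  by move=> k x y; rewrite scaler0 addr0.
move: w; apply: word_ind => [|i w IHw]; first exact: double_jacobiator1.
rewrite -malgUM [LHS](double_jacobiatorM brP) [X in lmul3 _ X]IHw.
rewrite [X in rmul3 _ X]J0.
by rewrite (linear_map0 (lmul3_linear _)) (linear_map0 (rmul3_linear _)) addr0.
Qed.

(** Vanishing extends from generators to A in the last argument, by the Leibniz
    rule; rotation brings the other two arguments to that slot. *)
Lemma double_jacobiator_eq0 :
  (forall i j k, double_jacobiator br (gen i) (gen j) (gen k) = 0) ->
  forall a b c, double_jacobiator br a b c = 0.
Proof.
move=> J0 a b c; have rot0 := linear_map0 (@rot3_linear C n).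
have J1 i j c1 : double_jacobiator br (gen i) (gen j) c1 = 0.
  exact: double_jacobiator_eq0r.
have J2 i b1 c1 : double_jacobiator br (gen i) b1 c1 = 0.
  move: c1; apply: double_jacobiator_eq0r => j.
  by rewrite double_jacobiator_rot double_jacobiator_rot J1 rot0 rot0.
move: c; apply: double_jacobiator_eq0r => i.
by rewrite double_jacobiator_rot double_jacobiator_rot J2 rot0 rot0.
Qed.

End JacobiGenerators.

(** * Coordinates *)

Section Coordinates.
Variables (C : fieldType) (n : nat).
Local Notation word := {fmonom 'I_n}.
Local Notation A := (free_alg C n).

Lemma mcoeff_linear (K : choiceType) (k : K) :
  linear (fun t : {malg C[K]} => t@_k : C^o).
Proof. by move=> c s t; rewrite mcoeffD mcoeffZ. Qed.

Lemma mcoeff_tens (K L : choiceType) (a : {malg C[K]}) (b : {malg C[L]}) k l :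
  (a ⊗ b)@_(k, l) = a@_k * b@_l.
Proof.
move: a; apply: (@eq_linear _ _ C^o (fun a => (a ⊗ b)@_(k, l))
  (fun a => a@_k * b@_l)) => [||k'].
- exact: (linear_comp (mcoeff_linear _) (tens_linearl b)).
- by move=> c s t; rewrite mcoeffD mcoeffZ mulrDl -mulrA.
move: b; apply: (@eq_linear _ _ C^o (fun b => (<< k' >> ⊗ b)@_(k, l))
  (fun b => << k' >>@_k * b@_l)) => [||l'].
- exact: (linear_comp (mcoeff_linear _) (tens_linearr _)).
- by move=> c s t; rewrite mcoeffD mcoeffZ mulrDr mulrCA.
by rewrite tensUU !mcoeffU -pair_eqE /=; case: eqP; case: eqP;
  rewrite ?mulr0 ?mul0r ?mulr1.
Qed.

Lemma mcoeff_gen (i j : 'I_n) : (gen i : A)@_(fmu j) = (i == j)%:R.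
Proof.
rewrite /gen mcoeffU; congr (_ *+ nat_of_bool _).
by rewrite fmP !fmU eqseq_cons andbT.
Qed.

Lemma mcoeff_1_fmu (j : 'I_n) : (1 : A)@_(fmu j) = 0.
Proof. by rewrite mcoeff1 fm1_eq1. Qed.

Lemma mcoeff_1_1 : (1 : A)@_(@mone word) = 1.
Proof. by rewrite mcoeff1 eqxx. Qed.

Definition embV (v : 'rV[C]_n) : A := \sum_(i < n) v 0 i *: gen i.

Lemma embV_linear : linear embV.
Proof.
apply: linear_sum_fun => i c u v.
by rewrite !mxE scalerDl scalerA.
Qed.

Lemma embV_delta i : embV (delta_mx 0 i) = gen i.
Proof.
rewrite /embV (bigD1 i) //= mxE !eqxx scale1r big1 ?addr0 // => j ji.
by rewrite mxE (negbTE ji) scale0r.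
Qed.

Lemma mcoeff_embV v i : (embV v)@_(fmu i) = v 0 i.
Proof.
rewrite /embV (linear_map_sum (mcoeff_linear _)) (bigD1 i) //= big1.
  by rewrite mcoeffZ mcoeff_gen eqxx mulr1 addr0.
by move=> j ji; rewrite mcoeffZ mcoeff_gen (negbTE ji) mulr0.
Qed.

End Coordinates.

(** * The triple bracket on generators and the associator *)

Section LinearBracket.
Variables (C : fieldType) (n : nat).
Local Notation word := {fmonom 'I_n}.
Local Notation A := (free_alg C n).
Local Notation A2 := (free_alg2 C n).
Local Notation A3 := (free_alg3 C n).
Local Notation V := 'rV[C]_n.

Lemma eq_linear_rV (W : lmodType C) (f g : V -> W) : linear f -> linear g ->
  (forall i, f (delta_mx 0 i) = g (delta_mx 0 i)) -> f =1 g.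
Proof.
move=> fl gl fg v; rewrite [v]row_sum_delta (linear_map_sum fl).
rewrite (linear_map_sum gl); apply: eq_bigr => i _.
by rewrite (linear_mapZ fl) (linear_mapZ gl) fg.
Qed.

Lemma subr_rotate3 (W : zmodType) (a b c d e g : W) :
  (a - d) + (c - g) + (e - b) = (a - b) + (c - d) + (e - g).
Proof.
have E (x y z x' y' z' : W) :
    (x - x') + (y - y') + (z - z') = (x + y + z) - (x' + y' + z').
  by rewrite !opprD [X in X + _ = _]addrACA [LHS]addrACA.
by rewrite !E; congr (_ - _); rewrite addrC addrA.
Qed.

Section Associator.
Variables (br : A2 -> A2) (m : V -> V -> V).
Hypothesis brP : double_bracket br.
Hypothesis br_embV : forall u v,
  br (embV u ⊗ embV v) = embV (m u v) ⊗ 1 - 1 ⊗ embV (m v u).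

Lemma sweedler_bracket_embV (W : lmodType C) (f : A -> A -> W) u v :
  (forall b, linear (f^~ b)) -> (forall a, linear (f a)) ->
  sweedler (br (embV u ⊗ embV v)) f = f (embV (m u v)) 1 - f 1 (embV (m v u)).
Proof.
move=> fl fr; rewrite [X in sweedler X]br_embV.
rewrite (linear_mapB (sweedler_linearl f)).
by rewrite [X in X - _](sweedlerT _ _ fl fr) [X in _ - X](sweedlerT _ _ fl fr).
Qed.

(** The unit in the second summand of the outer bracket kills the inner one, so
    only the product m v w is bracketed again. *)
Lemma sweedler_bracket2_embV (H : A -> A -> A -> A3) u v w :
  (forall y z, linear (fun x => H x y z)) ->
  (forall x z, linear (fun y => H x y z)) ->
  (forall x y, linear (fun z => H x y z)) ->
  sweedler (br (embV v ⊗ embV w)) (fun x y =>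
    sweedler (br (embV u ⊗ x)) (fun p q => H p q y)) =
  H (embV (m u (m v w))) 1 1 - H 1 (embV (m (m v w) u)) 1.
Proof.
move=> H1 H2 H3; rewrite [LHS]sweedler_bracket_embV => [|b|a].
- rewrite [X in _ - X](_ : _ = 0) ?subr0; last first.
    by rewrite bracketx1 // (linear_map0 (sweedler_linearl _)).
  rewrite [LHS](sweedler_bracket_embV (f := fun p q => H p q 1)) //.
- exact: (linear_comp (sweedler_linearl _) (bracket_linearr brP _)).
by apply: sweedler_linear => p q; exact: H3.
Qed.

(** The six nested products pair up into one associator per tensor slot. *)
Lemma double_jacobiator_embV u v w :
  double_jacobiator br (embV u) (embV v) (embV w) =
    embV (m u (m v w) - m (m u v) w) ⊗ 1 ⊗ 1 +
    1 ⊗ embV (m v (m w u) - m (m v w) u) ⊗ 1 +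
    1 ⊗ 1 ⊗ embV (m w (m u v) - m (m w u) v).
Proof.
have tl12 (y z : A) : linear (fun x : A => x ⊗ y ⊗ z).
  exact: (linear_comp (tens_linearl z) (tens_linearl y)).
have tr12 (x z : A) : linear (fun y : A => x ⊗ y ⊗ z).
  exact: (linear_comp (tens_linearl z) (tens_linearr x)).
have tr3 (x y : A) : linear (fun z : A => x ⊗ y ⊗ z) by exact: tens_linearr.
rewrite [LHS]double_jacobiatorE.
rewrite [X in X + _ + _ = _](sweedler_bracket2_embV
  (H := fun p q y => p ⊗ q ⊗ y) u v w tl12 tr12 tr3).
rewrite [X in _ + X + _ = _](sweedler_bracket2_embV
  (H := fun p q y => y ⊗ p ⊗ q) v w u
  (fun y z => tr12 z y) (fun x z => tr3 z x) tl12).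
rewrite [X in _ + _ + X = _](sweedler_bracket2_embV
  (H := fun p q y => q ⊗ y ⊗ p) w u v
  tr3 (fun x z => tl12 z x) (fun x y => tr12 y x)).
have B1 (e : A) (x y : V) : embV (x - y) ⊗ e ⊗ e =
    embV x ⊗ e ⊗ e - embV y ⊗ e ⊗ e.
  by have := linear_mapB (linear_comp (tl12 e e) (@embV_linear C n)) x y.
have B2 (e : A) (x y : V) : e ⊗ embV (x - y) ⊗ e =
    e ⊗ embV x ⊗ e - e ⊗ embV y ⊗ e.
  by have := linear_mapB (linear_comp (tr12 e e) (@embV_linear C n)) x y.
have B3 (e : A) (x y : V) : e ⊗ e ⊗ embV (x - y) =
    e ⊗ e ⊗ embV x - e ⊗ e ⊗ embV y.
  by have := linear_mapB (linear_comp (tr3 e e) (@embV_linear C n)) x y.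
rewrite [X in _ = X + _ + _]B1 [X in _ = _ + X + _]B2 [X in _ = _ + _ + X]B3.
exact: subr_rotate3.
Qed.

Lemma associative_double_jacobi :
  associative m -> forall a b c, double_jacobiator br a b c = 0.
Proof.
move=> mA; apply: (double_jacobiator_eq0 brP) => i j k.
rewrite -!(embV_delta C) [LHS]double_jacobiator_embV !mA !subrr.
rewrite (linear_map0 (@embV_linear C n)).
have t0l K L (b : {malg C[L]}) : (0 : {malg C[K]}) ⊗ b = 0.
  exact: linear_map0 (tens_linearl b).
have t0r K L (a : {malg C[K]}) : a ⊗ (0 : {malg C[L]}) = 0.
  exact: linear_map0 (tens_linearr a).
by rewrite [X in X ⊗ 1 + _ + _]t0l [X in X + _ + _]t0l [X in _ + X ⊗ 1 + _]t0r
  [X in _ + X + _]t0l [X in _ + X]t0r !addr0.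
Qed.

(** The coefficient of the triple bracket at x_l (x) 1 (x) 1 is a coordinate of
    a single associator: the other two terms have 1 in their first slot. *)
Lemma double_jacobi_associative :
  (forall a b c, double_jacobiator br a b c = 0) -> associative m.
Proof.
move=> J0 u v w; apply/eqP; rewrite -subr_eq0; apply/eqP/rowP => l.
have /(congr1 (mcoeff (fmu l, @mone word, @mone word))) :=
  double_jacobiator_embV u v w.
rewrite [X in mcoeff _ X = _]J0 mcoeff0 !mcoeffD.
have c3 (x y z : A) : (x ⊗ y ⊗ z)@_(fmu l, @mone word, @mone word) =
    x@_(fmu l) * y@_(@mone word) * z@_(@mone word).
  by rewrite mcoeff_tens mcoeff_tens.
rewrite [X in _ = X + _ + _]c3 [X in _ = _ + X + _]c3 [X in _ = _ + X]c3.
rewrite mcoeff_embV mcoeff_1_1 mcoeff_1_fmu !mul0r !mulr1 !addr0.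
by move=> <-; rewrite mxE.
Qed.

End Associator.

(** * Linear brackets from structure constants *)

Implicit Types c : 'I_n -> 'I_n -> 'I_n -> C.

Definition mul_of_consts c (u v : V) : V :=
  \sum_(i < n) \sum_(j < n) (u 0 i * v 0 j) *: \row_k c i j k.

Lemma mul_of_consts_linearl c v : linear (mul_of_consts c ^~ v).
Proof.
apply: linear_sum_fun => i; apply: linear_sum_fun => j a u u'.
by rewrite !mxE mulrDl scalerDl -mulrA scalerA.
Qed.

Lemma mul_of_consts_linearr c u : linear (mul_of_consts c u).
Proof.
apply: linear_sum_fun => i; apply: linear_sum_fun => j a v v'.
by rewrite !mxE mulrDr scalerDl mulrCA scalerA.
Qed.

Lemma mul_of_consts_delta c i j :
  mul_of_consts c (delta_mx 0 i) (delta_mx 0 j) = \row_k c i j k.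
Proof.
rewrite /mul_of_consts (bigD1 i) //= (bigD1 j) //= !mxE !eqxx mulr1 scale1r.
rewrite big1 => [|j' jj]; last by rewrite !mxE (negbTE jj) andbF mulr0 scale0r.
rewrite big1 ?addr0 // => i' ii; rewrite big1 // => j' _.
by rewrite !mxE (negbTE ii) andbF mul0r scale0r.
Qed.

Definition linear_form c (a b : A) : A2 :=
  \sum_(i < n) \sum_(j < n) \sum_(k < n)
    c i j k *: prod_bracket (inner (gen k) (partial i) 1) (partial j) a b.

Definition linear_bracket c (t : A2) : A2 := sweedler t (linear_form c).

Lemma coef_partial_derivation (i k : 'I_n) :
  double_derivation (inner (gen k : A) (partial i) 1).
Proof. by apply: inner_double_derivation; exact: partialM. Qed.

Lemma linear_form_linearl c b : linear (linear_form c ^~ b).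
Proof.
do 3!apply: linear_sum_fun => ?; apply: linear_scale.
apply: prod_bracket_linearl; last exact: partialM.
exact: coef_partial_derivation.
Qed.

Lemma linear_form_derivation c a : double_derivation (linear_form c a).
Proof.
do 3!apply: double_derivation_sum => ?; apply: double_derivation_scale.
apply: prod_bracket_derivation; last exact: partialM.
exact: coef_partial_derivation.
Qed.

Lemma linear_bracketE c a b : linear_bracket c (a ⊗ b) = linear_form c a b.
Proof.
apply: sweedlerT => x; first exact: linear_form_linearl.
exact: (linear_form_derivation c x).1.
Qed.

Lemma linear_form_antisym c a b : linear_form c a b = - flip (linear_form c b a).
Proof.
have fl := @flip_linear C n.
rewrite (linear_map_sum fl) -sumrN; apply: eq_bigr => i _.
rewrite (linear_map_sum fl) -sumrN; apply: eq_bigr => j _.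
rewrite (linear_map_sum fl) -sumrN; apply: eq_bigr => k _.
rewrite (linear_mapZ fl) -scalerN; apply: f_equal.
exact: prod_bracket_antisym.
Qed.

Lemma linear_bracket_double c : double_bracket (linear_bracket c).
Proof.
split=> [|a|a b]; first exact: sweedler_linearl.
  rewrite (_ : (fun b => _) = linear_form c a).
    exact: linear_form_derivation.
  by apply: funext => b; exact: linear_bracketE.
rewrite [LHS]linear_bracketE [X in flip X]linear_bracketE.
exact: linear_form_antisym.
Qed.

Lemma linear_bracketP c : linear_double_bracket (linear_bracket c).
Proof.
split; first exact: linear_bracket_double.
by exists c; exact: linear_bracketE.
Qed.

Lemma partial_gen (i j : 'I_n) : partial i (gen j : A) = (i == j)%:R *: (1 ⊗ 1).
Proof.
by have [_ -> _] := partialP C i; case: eqP; rewrite ?scale1r ?scale0r.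
Qed.

Lemma inner_partial_gen (i j : 'I_n) (x y : A) :
  inner x (partial i) y (gen j : A) = (i == j)%:R *: (y ⊗ x).
Proof.
rewrite -[LHS]/(inner_act x (partial i (gen j)) y).
rewrite [X in inner_act x X]partial_gen.
rewrite (linear_mapZ (inner_act_linear x y)); apply: f_equal.
by rewrite [LHS]inner_actT mul1r mulr1.
Qed.

(** The Sweedler sums of both terms consist of the single pure tensors that
    x_k d/dx_i and d/dx_j take on generators, 1 (x) x_k and 1 (x) 1. *)
Lemma prod_bracket_gen (i j k p q : 'I_n) :
  prod_bracket (inner (gen k) (partial i) 1) (partial j) (gen p) (gen q : A) =
    ((i == p) && (j == q))%:R *: (gen k ⊗ 1) -
    ((i == q) && (j == p))%:R *: (1 ⊗ gen k).
Proof.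
rewrite /prod_bracket.
rewrite [X in sweedler X _ - _]inner_partial_gen.
rewrite [X in _ - sweedler X _]partial_gen.
rewrite [X in X - _ = _]sweedlerZ [X in _ - X = _]sweedlerZ.
have E1 : sweedler (1 ⊗ gen k) (fun u v => inner u (partial j) v (gen q : A)) =
    (j == q)%:R *: (gen k ⊗ 1).
  rewrite [X in sweedler X]tensUU [LHS]sweedlerU; exact: inner_partial_gen.
have E2 : sweedler (1 ⊗ 1) (fun u v =>
      inner u (inner (gen k) (partial i) 1) v (gen q : A)) =
    (i == q)%:R *: (1 ⊗ gen k).
  rewrite [X in sweedler X]tensUU [LHS]sweedlerU.
  rewrite -[LHS]/(inner_act 1 (inner (gen k) (partial i) 1 (gen q)) 1).
  rewrite [X in inner_act 1 X]inner_partial_gen.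
  rewrite (linear_mapZ (inner_act_linear _ _)); apply: f_equal.
  by rewrite [LHS]inner_actT mulr1 mul1r.
rewrite [X in _ *: X - _ = _]E1 [X in _ - _ *: X = _]E2 !scalerA -!natrM !mulnb.
by rewrite [(j == p) && _]andbC.
Qed.

Lemma sum_delta2 (W : lmodType C) (p q : 'I_n) (G : 'I_n -> 'I_n -> W) :
  \sum_(i < n) \sum_(j < n) ((i == p) && (j == q))%:R *: G i j = G p q.
Proof.
rewrite (bigD1 p) //= (bigD1 q) //= !eqxx scale1r.
rewrite big1 => [|j /negbTE jq]; last by rewrite jq andbF scale0r.
rewrite big1 ?addr0 // => i /negbTE ip; apply: big1 => j _.
by rewrite ip scale0r.
Qed.

Lemma sum_structure (W : lmodType C) c (p q : 'I_n) (x y : 'I_n -> W) :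
  \sum_(i < n) \sum_(j < n) \sum_(k < n) c i j k *:
    (((i == p) && (j == q))%:R *: x k - ((i == q) && (j == p))%:R *: y k) =
  \sum_(k < n) (c p q k *: x k - c q p k *: y k).
Proof.
rewrite sumrB -(sum_delta2 p q (fun i j => \sum_(k < n) c i j k *: x k)).
rewrite -(sum_delta2 q p (fun i j => \sum_(k < n) c i j k *: y k)) -sumrB.
apply: eq_bigr => i _; rewrite -sumrB; apply: eq_bigr => j _.
rewrite !scaler_sumr -sumrB; apply: eq_bigr => k _.
by rewrite scalerBr !scalerA mulrC [c i j k * (_ && (j == p))%:R]mulrC.
Qed.

Lemma linear_bracket_gen c p q : linear_bracket c (gen p ⊗ gen q) =
  \sum_(k < n) (c p q k *: (gen k ⊗ 1) - c q p k *: (1 ⊗ gen k)).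
Proof.
rewrite [LHS]linear_bracketE -[RHS]sum_structure.
apply: eq_bigr => i _; apply: eq_bigr => j _; apply: eq_bigr => k _.
by apply: f_equal; exact: prod_bracket_gen.
Qed.

Lemma embV_row (f : 'I_n -> C) : embV (\row_k f k) = \sum_(k < n) f k *: gen k.
Proof. by apply: eq_bigr => k _; rewrite mxE. Qed.

Lemma linear_bracket_embV c u v : linear_bracket c (embV u ⊗ embV v) =
  embV (mul_of_consts c u v) ⊗ 1 - 1 ⊗ embV (mul_of_consts c v u).
Proof.
have brP := linear_bracket_double c; have il := @embV_linear C n.
have il1 := linear_comp (tens_linearl (1 : A)) il.
have ir1 := linear_comp (tens_linearr (1 : A)) il.
move: v; apply: eq_linear_rV => [||j].
- exact: (linear_comp (bracket_linearr brP _) il).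
- apply: linear_add; last apply: linear_opp.
    exact: (linear_comp il1 (mul_of_consts_linearr c u)).
  exact: (linear_comp ir1 (mul_of_consts_linearl c u)).
move: u; apply: eq_linear_rV => [||i].
- exact: (linear_comp (bracket_linearl brP _) il).
- apply: linear_add; last apply: linear_opp.
    exact: (linear_comp il1 (mul_of_consts_linearl c _)).
  exact: (linear_comp ir1 (mul_of_consts_linearr c _)).
rewrite !mul_of_consts_delta !embV_row !embV_delta [LHS]linear_bracket_gen.
rewrite sumrB; apply: f_equal2; last apply: f_equal; symmetry.
  rewrite (linear_map_sum (tens_linearl _)); apply: eq_bigr => k _.
  exact: (linear_mapZ (tens_linearl _)).
rewrite (linear_map_sum (tens_linearr _)); apply: eq_bigr => k _.
exact: (linear_mapZ (tens_linearr _)).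
Qed.

Lemma linear_bracket_poisson c :
  linear_double_poisson_bracket (linear_bracket c) <->
  associative (mul_of_consts c).
Proof.
have brP := linear_bracket_double c.
split=> [[_ [_ J0]]|mA].
  exact: (double_jacobi_associative brP (linear_bracket_embV c)).
split; first exact: linear_bracketP.
split=> //; exact: (associative_double_jacobi brP (linear_bracket_embV c)).
Qed.

(** * The correspondence *)

Definition consts_of_mul (m : V -> V -> V) (i j k : 'I_n) : C :=
  m (delta_mx 0 i) (delta_mx 0 j) 0 k.

Definition consts_of_bracket (br : A2 -> A2) (i j k : 'I_n) : C :=
  (br (gen i ⊗ gen j))@_(fmu k, @mone word).

Lemma consts_of_mulK (m : V -> V -> V) :
  (forall v, linear (m^~ v)) -> (forall u, linear (m u)) ->
  mul_of_consts (consts_of_mul m) = m.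
Proof.
move=> ml mr; apply: funext => u; apply: funext => v.
move: v; apply: eq_linear_rV => [|//|j]; first exact: mul_of_consts_linearr.
move: u; apply: (eq_linear_rV (f := mul_of_consts _ ^~ _)
  (g := m^~ _)) => [|//|i].
  exact: mul_of_consts_linearl.
by rewrite mul_of_consts_delta; apply/rowP => k; rewrite mxE.
Qed.

Lemma mul_of_constsK c : consts_of_mul (mul_of_consts c) = c.
Proof.
apply: funext => i; apply: funext => j; apply: funext => k.
by rewrite /consts_of_mul mul_of_consts_delta mxE.
Qed.

(** c i j k is the coefficient at x_k (x) 1; the summand 1 (x) x_k does not
    contribute to it. *)
Lemma linear_bracketK c : consts_of_bracket (linear_bracket c) = c.
Proof.
apply: funext => i; apply: funext => j; apply: funext => k.
rewrite /consts_of_bracket -!(embV_delta C) linear_bracket_embV mcoeffB.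
rewrite [X in X - _]mcoeff_tens [X in _ - X]mcoeff_tens.
rewrite mcoeff_embV mcoeff_1_1 mcoeff_1_fmu mulr1 mul0r subr0.
by rewrite mul_of_consts_delta mxE.
Qed.

(** A linear double bracket comes with some constants c; they are the ones read
    off from its values on generators. *)
Lemma consts_of_bracketK br : linear_double_bracket br ->
  linear_bracket (consts_of_bracket br) = br.
Proof.
case=> -[brl _ _] [c brE].
have -> : br = linear_bracket c.
  apply: funext; apply: eq_linear => [//||[u v]]; first exact: sweedler_linearl.
  by rewrite -tensUU brE [RHS]linear_bracketE.
by rewrite linear_bracketK.
Qed.

End LinearBracket.

Theorem proposition1 (C : closedFieldType) (C_char0 : [pchar C] =i pred0)
    (n : nat) (n_gt0 : (0 < n)%N) :
  exists F : {mul : 'rV[C]_n -> 'rV[C]_n -> 'rV[C]_n | assoc_alg_structure mul} ->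
             {br : free_alg2 C n -> free_alg2 C n |
               linear_double_poisson_bracket br},
    bijective F /\
    forall (A : {mul : 'rV[C]_n -> 'rV[C]_n -> 'rV[C]_n | assoc_alg_structure mul})
           (c : 'I_n -> 'I_n -> 'I_n -> C),
      (forall i j : 'I_n, sval A (delta_mx 0 i) (delta_mx 0 j) =
         \sum_(k < n) c i j k *: delta_mx 0 k) ->
      forall i j : 'I_n, sval (F A) (gen i ⊗ gen j) =
        \sum_(k < n) (c i j k *: (gen k ⊗ 1) - c j i k *: (1 ⊗ gen k)).
Proof.
have FP (A : {mul : 'rV[C]_n -> 'rV[C]_n -> 'rV[C]_n | assoc_alg_structure mul}) :
    linear_double_poisson_bracket (linear_bracket (consts_of_mul (sval A))).
  case: A => m [ml mr mA] /=; apply/linear_bracket_poisson.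
  by rewrite consts_of_mulK.
have GP (B : {br : free_alg2 C n -> free_alg2 C n |
      linear_double_poisson_bracket br}) :
    assoc_alg_structure (mul_of_consts (consts_of_bracket (sval B))).
  case: B => br brP /=; split; [exact: mul_of_consts_linearl
    | exact: mul_of_consts_linearr |].
  by apply/linear_bracket_poisson; rewrite consts_of_bracketK //; case: brP.
exists (fun A => exist _ _ (FP A)); split.
  exists (fun B => exist _ _ (GP B)) => [[m mP]|[br brP]]; apply: eq_exist => /=.
    by rewrite linear_bracketK; case: mP => ml mr _; apply: consts_of_mulK.
  by rewrite mul_of_constsK; case: brP => brl _; apply: consts_of_bracketK.
move=> [m mP] c mE i j /=; rewrite /= in mE.
rewrite [LHS]linear_bracket_gen.
have -> : consts_of_mul m = c; last by [].
apply: funext => a; apply: funext => b; apply: funext => k.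
rewrite /consts_of_mul mE summxE (bigD1 k) //= !mxE !eqxx mulr1.
by rewrite big1 ?addr0 // => l /negbTE lk; rewrite !mxE eq_sym lk mulr0.
Qed.
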